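(* Let $\mathcal{A}$ be a unital $C^*$-algebra. For any faithful state $\omega$ of $\mathcal{A}$, $$\sigma_2^\omega(a)=\omega(|a-\omega(a)|^2)^{1/2}\qquad(a\in\mathcal{A})$$ is a strongly Leibniz seminorm on $\mathcal{A}$.
   Context: For $a\in\mathcal{A}$, $|a|^2=a^*a$, and a scalar $\lambda$ in $a-\lambda$ stands for $\lambda\mathbf{1}_\mathcal{A}$. A seminorm $L$ on a unital normed algebra $(\mathcal{A},\|\cdot\|)$ is called strongly Leibniz if (i) $L(1_\mathcal{A})=0$; (ii) $L(ab)\le\|a\|L(b)+\|b\|L(a)$ for all $a,b\in\mathcal{A}$; and (iii) $L(a^{-1})\le\|a^{-1}\|^2L(a)$ for every invertible $a\in\mathcal{A}$. Here $\|\cdot\|$ is the $C^*$-norm of $\mathcal{A}$. *)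

(* Defs.v *)
From HB Require Import structures.
From mathcomp Require Import all_boot all_order all_algebra.
From mathcomp Require Import complex reals.

Set Implicit Arguments.
Unset Strict Implicit.
Unset Printing Implicit Defensive.

Import Order.TTheory GRing.Theory Num.Theory.
Local Open Scope ring_scope.

(* Hierarchy-Builder admits no common substructure of algType and normedModType
   on one carrier: the two meet already in numDomainType (a ring normed over
   itself), so such a join would have to be declared below it.  Hence the norm
   is an operation of its own on an algType.  As in normedModType, norms take
   values in the field of scalars; 0 <= z there entails that z is real. *)
HB.mixin Record isNormedAlgebra (K : numFieldType) A of GRing.Algebra K A := {
  anorm : A -> K;
  anorm_ge0 : forall a : A, 0 <= anorm a;
  anorm0_eq0 : forall a : A, anorm a = 0 -> a = 0;
  anormZ : forall (k : K) (a : A), anorm (k *: a) = `|k| * anorm a;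
  ler_anormD : forall a b : A, anorm (a + b) <= anorm a + anorm b;
  ler_anormM : forall a b : A, anorm (a * b) <= anorm a * anorm b
}.

#[short(type="normedAlgType")]
HB.structure Definition NormedAlgebra (K : numFieldType) :=
  {A of GRing.Algebra K A & isNormedAlgebra K A}.

Definition anorm_cauchy (K : numFieldType) (A : normedAlgType K)
    (u : nat -> A) : Prop :=
  forall e : K, 0 < e ->
  exists N, forall m n, (N <= m)%N -> (N <= n)%N -> anorm (u m - u n) < e.

Definition anorm_cvg (K : numFieldType) (A : normedAlgType K)
    (u : nat -> A) (l : A) : Prop :=
  forall e : K, 0 < e ->
  exists N, forall n, (N <= n)%N -> anorm (u n - l) < e.

HB.mixin Record isCStarAlgebra (R : realType) A of NormedAlgebra R[i] A := {
  anorm_complete : forall u : nat -> A,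
    anorm_cauchy u -> exists l : A, anorm_cvg u l;
  star : A -> A;
  starK : forall a : A, star (star a) = a;
  starD : forall a b : A, star (a + b) = star a + star b;
  starZ : forall (k : R[i]) (a : A), star (k *: a) = Num.conj k *: star a;
  starM : forall a b : A, star (a * b) = star b * star a;
  anorm_starM : forall a : A, anorm (star a * a) = anorm a ^+ 2
}.

(* The zero algebra is excluded, since 1 != 0 in an algType; it has no state. *)
#[short(type="cstarAlgType")]
HB.structure Definition CStarAlgebra (R : realType) :=
  {A of NormedAlgebra R[i] A & isCStarAlgebra R A}.

Definition abs_sqr (R : realType) (A : cstarAlgType R) (a : A) : A :=
  star a * a.

Definition is_state (R : realType) (A : cstarAlgType R)
    (omega : {scalar A}) : Prop :=
  (forall a : A, 0 <= omega (abs_sqr a)) /\ omega 1 = 1.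

Definition is_faithful (R : realType) (A : cstarAlgType R)
    (omega : {scalar A}) : Prop :=
  forall a : A, omega (abs_sqr a) = 0 -> a = 0.

Definition is_seminorm (K : numFieldType) (A : normedAlgType K)
    (L : A -> K) : Prop :=
  [/\ forall a : A, 0 <= L a,
      forall (k : K) (a : A), L (k *: a) = `|k| * L a
    & forall a b : A, L (a + b) <= L a + L b].

(* An algType has no inverse operation: in the last clause b stands for the
   inverse of a. *)
Definition strongly_leibniz (K : numFieldType) (A : normedAlgType K)
    (L : A -> K) : Prop :=
  [/\ L 1 = 0,
      forall a b : A, L (a * b) <= anorm a * L b + anorm b * L a
    & forall a b : A, a * b = 1 -> b * a = 1 -> L b <= anorm b ^+ 2 * L a].

(* For z >= 0, sqrtC z is the nonnegative square root of z. *)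
Definition sigma2 (R : realType) (A : cstarAlgType R) (omega : {scalar A})
    (a : A) : R[i] :=
  sqrtC (omega (abs_sqr (a - (omega a)%:A))).

(* Main.v *)
Require Import Defs.
From mathcomp Require Import all_boot all_order all_algebra.
From mathcomp Require Import complex reals.
From mathcomp Require Import ring.

(** Write [N x = omega (x^* x)^(1/2)] for the seminorm of the GNS construction,
    so that [sigma a = N (a - omega a)].  Two facts about [N] carry the proof.

    Left multiplication is bounded: [N (a x) <= ||a|| N x] (state_normM).
    Indeed, if [||a|| < 1] then [1 - a^* a] is the square of a self-adjoint
    [s], so that [x^* x - x^* a^* a x = (s x)^* (s x)] has a nonnegative value.
    The square root [s = 1 - y] comes from the fixed point of the contraction
    [y |-> (h + y^2) / 2], where [h = a^* a].  The general case follows by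
    scaling.

    The mean is the best constant: [sigma a] is the least of the [N (a - k)]
    over scalars [k], being the distance from [a] to the line of the unit.

    The Leibniz rule follows by approximating [a b] by the constant
    [omega a * omega b]:
      [a b - omega a * omega b = a (b - omega b) + omega b (a - omega a)],
    together with [|omega b| <= ||b||].

    For the inverse [b] of [a], the number [sigma b ^ 2] is the Gram
    determinant of the vectors [b] and [1], as [N 1 = 1].  Subtracting a
    multiple of [b] from [1] does not change this determinant, and
    [1 - omega a * b = b (a - omega a)].  A Gram determinant is at most the
    product of the squared lengths, whence
      [sigma b <= N b * N (b (a - omega a)) <= ||b|| * (||b|| * sigma a)]. *)

Set Implicit Arguments.
Unset Strict Implicit.
Unset Printing Implicit Defensive.

Import Order.TTheory GRing.Theory Num.Theory.
Local Open Scope ring_scope.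

(** * Geometric sequences of complex numbers *)

(** A nonnegative element of [R[i]] is real, so that this is the archimedean
    property of [R]. *)
Lemma complex_natr_gt (R : realType) (x : R[i]) :
  0 <= x -> exists n : nat, x < n%:R.
Proof.
move=> x0; exists (Num.bound (complex.Re x)).
have xE : x = (complex.Re x)%:C%C by rewrite RRe_real // ger0_real.
rewrite {1}xE -(rmorph_nat (@real_complex R)) ltcR archi_boundP //.
by move: x0; rewrite {1}xE -(rmorph0 (@real_complex R)) lecR.
Qed.

(** Bernoulli's inequality, in a form that bounds [r ^+ n] by
    [1 / (1 + n (1 - r))] without dividing by [r]. *)
Lemma bernoulli_exprn (K : numFieldType) (r : K) n :
  0 <= r -> r <= 1 -> r ^+ n * (1 + n%:R * (1 - r)) <= 1.
Proof.
move=> r0 r1; have d0 : 0 <= 1 - r by rewrite subr_ge0.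
elim: n => [|n IHn]; first by rewrite expr0 mul0r addr0 mulr1.
apply: le_trans IHn; rewrite exprSr -mulrA ler_wpM2l ?exprn_ge0 //.
rewrite -subr_ge0.
have -> : 1 + n%:R * (1 - r) - r * (1 + n.+1%:R * (1 - r))
        = (1 - r) ^+ 2 * (1 + n%:R) by rewrite -natr1; ring.
by rewrite mulr_ge0 ?exprn_ge0 // addr_ge0.
Qed.

Lemma exprn_small (R : realType) (r e : R[i]) :
  0 <= r -> r < 1 -> 0 < e -> exists N, forall n, (N <= n)%N -> r ^+ n < e.
Proof.
move=> r0 r1 e0; have d0 : 0 < 1 - r by rewrite subr_gt0.
have [|N hN] := @complex_natr_gt R ((e * (1 - r))^-1).
  by rewrite invr_ge0 mulr_ge0 // ltW.
exists N => n leNn; apply: (@le_lt_trans _ _ (r ^+ N)).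
  by rewrite ler_wiXn2l // ltW.
have N1 : 1 < e * (1 + N%:R * (1 - r)).
  rewrite mulrDr mulr1; apply: (@lt_le_trans _ _ (e * (N%:R * (1 - r)))).
    move: hN; rewrite -(ltr_pM2l (mulr_gt0 e0 d0)) divff ?gt_eqF ?mulr_gt0 //.
    by congr (_ < _); ring.
  by rewrite lerDr ltW.
have pos : 0 < 1 + N%:R * (1 - r).
  by rewrite ltr_wpDr // mulr_ge0 // ltW.
rewrite -(ltr_pM2r pos); apply: le_lt_trans N1.
by apply: bernoulli_exprn => //; apply: ltW.
Qed.

(** * Normed algebras *)

Section NormedAlgebra.
Variables (K : numFieldType) (A : normedAlgType K).
Implicit Types a b c : A.

Lemma anorm_zero : anorm (0 : A) = 0.
Proof. by rewrite -(scale0r (0 : A)) anormZ normr0 mul0r. Qed.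

Lemma anormN a : anorm (- a) = anorm a.
Proof. by rewrite -scaleN1r anormZ normrN1 mul1r. Qed.

Lemma anorm_distC a b : anorm (a - b) = anorm (b - a).
Proof. by rewrite -anormN opprB. Qed.

Lemma ler_anorm_dist c a b : anorm (a - b) <= anorm (a - c) + anorm (c - b).
Proof. by rewrite (le_trans _ (ler_anormD _ _)) // addrA subrK. Qed.

Lemma anorm_subsqr a b :
  anorm (a * a - b * b) <= (anorm a + anorm b) * anorm (a - b).
Proof.
have -> : a * a - b * b = a * (a - b) + (a - b) * b.
  by rewrite mulrBr mulrBl addrA subrK.
apply: le_trans (ler_anormD _ _) _; rewrite [X in _ <= X]mulrDl lerD ?ler_anormM //.
by rewrite [X in _ <= X]mulrC ler_anormM.
Qed.

(** Uniqueness of limits, with a constant [C] that absorbs the estimates. *)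
Lemma anorm_small_eq a b (C : K) : 0 <= C ->
  (forall e : K, 0 < e -> anorm (a - b) <= C * e) -> a = b.
Proof.
move=> C0 small; apply/eqP; rewrite -subr_eq0; apply/eqP; apply: anorm0_eq0.
have C1 : 0 < C + 1 by rewrite ltr_wpDl.
have := anorm_ge0 (a - b); rewrite le0r => /orP[/eqP // | ab0].
have e0 := divr_gt0 ab0 C1.
have := small _ e0; rewrite mulrCA -{1}[anorm (a - b)]mulr1 ler_pM2l //.
rewrite ler_pdivlMr // mul1r => C1le.
by have := lt_le_trans (ltr_pwDr ltr01 (lexx C)) C1le; rewrite ltxx.
Qed.

End NormedAlgebra.

Lemma contraction_cauchy (R : realType) (A : normedAlgType R[i])
    (u : nat -> A) (r : R[i]) : 0 <= r -> r < 1 ->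
  (forall n, anorm (u n.+2 - u n.+1) <= r * anorm (u n.+1 - u n)) ->
  anorm_cauchy u.
Proof.
move=> r0 r1 contr; set c := anorm (u 1%N - u 0%N).
have c0 : 0 <= c := anorm_ge0 _.
have d0 : 0 < 1 - r by rewrite subr_gt0.
have step n : anorm (u n.+1 - u n) <= r ^+ n * c.
  elim: n => [|n IHn]; first by rewrite mul1r.
  by rewrite (le_trans (contr n)) // exprS -mulrA ler_wpM2l.
(* The factor [1 - r] makes the geometric sum telescope. *)
have tail n k : (1 - r) * anorm (u (n + k)%N - u n) <= r ^+ n * c.
  apply: (@le_trans _ _ (r ^+ n * c * (1 - r ^+ k))); last first.
    by rewrite ler_piMr ?mulr_ge0 ?exprn_ge0 // gerBl exprn_ge0.
  elim: k => [|k IHk].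
    by rewrite addn0 subrr anorm_zero subrr !mulr0.
  apply: (@le_trans _ _ ((1 - r) * (r ^+ (n + k) * c)
                         + r ^+ n * c * (1 - r ^+ k))).
    apply: le_trans (lerD (lexx _) IHk); rewrite -mulrDr ler_wpM2l ?(ltW d0) //.
    apply: le_trans (ler_anorm_dist (u (n + k)%N) _ _) _.
    by rewrite lerD2r addnS step.
  by rewrite le_eqVlt; apply/orP; left; apply/eqP; rewrite exprD exprS; ring.
move=> e e0; have c1 : 0 < c + 1 by rewrite ltr_wpDl.
have [N hN] := exprn_small r0 r1 (divr_gt0 (mulr_gt0 d0 e0) c1).
exists N => m n; wlog lenm : m n / (n <= m)%N.
  move=> wl Nm Nn; case/orP: (leq_total n m) => [|lemn]; first by move/wl; apply.
  by rewrite anorm_distC wl.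
move=> _ /hN; rewrite ltr_pdivlMr // => small.
rewrite -(ltr_pM2l d0); apply: le_lt_trans small.
rewrite -(subnKC lenm); apply: le_trans (tail _ _) _.
by rewrite ler_wpM2l ?exprn_ge0 // lerDl.
Qed.

(** * Involution and square roots *)

Section CStar.
Variables (R : realType) (A : cstarAlgType R).
Implicit Types a b h : A.

Lemma star1 : star (1 : A) = 1.
Proof. by rewrite -[LHS]mulr1 -{2}(starK 1) -starM mulr1 starK. Qed.

Lemma starN a : star (- a) = - star a.
Proof. by rewrite -scaleN1r starZ rmorphN1 scaleN1r. Qed.

Lemma starB a b : star (a - b) = star a - star b.
Proof. by rewrite starD starN. Qed.

Lemma star0 : star (0 : A) = 0.
Proof. by rewrite -(scale0r (0 : A)) starZ rmorph0 !scale0r. Qed.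

Lemma anorm_star a : anorm (star a) = anorm a.
Proof.
have le b : anorm b <= anorm (star b).
  have := ler_anormM (star b) b; rewrite anorm_starM expr2.
  have := anorm_ge0 b; rewrite le0r => /orP[/eqP -> _ | b0].
    exact: anorm_ge0.
  by rewrite ler_pM2r.
by apply/le_anti; rewrite le andbT -{2}(starK a) le.
Qed.

(** The equation [(1 - y)^2 = 1 - h] is the fixed point equation of
    [T y = (h + y^2) / 2], which maps the ball of radius [anorm h] into itself
    and contracts it by the factor [anorm h]. *)
Lemma sa_sqrt_one_sub h : star h = h -> anorm h < 1 ->
  exists2 s, star s = s & s * s = 1 - h.
Proof.
move=> hs h1; set r := anorm h; have r0 : 0 <= r := anorm_ge0 h.
pose T y := 2^-1 *: (h + y * y).
pose u n := iter n T 0.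
have half0 : 0 <= (2^-1 : R[i]) by rewrite invr_ge0.
have Tdist y z : anorm (T y - T z) <= 2^-1 * ((anorm y + anorm z) * anorm (y - z)).
  rewrite /T -scalerBr anormZ ger0_norm // ler_wpM2l //.
  by rewrite [h + _]addrC opprD addrA addrK anorm_subsqr.
have ur n : anorm (u n) <= r.
  elim: n => [|n IHn]; first by rewrite anorm_zero.
  rewrite /= anormZ ger0_norm // ler_pdivrMl // mulr2n mulrDl mul1r.
  apply: le_trans (ler_anormD _ _) _; rewrite lerD2l.
  apply: le_trans (ler_anormM _ _) _.
  apply: le_trans (ler_wpM2l (anorm_ge0 _) IHn) _.
  by apply: le_trans (ler_wpM2r r0 IHn) _; rewrite ler_piMr // ltW.
have us n : star (u n) = u n.
  elim: n => [|n IHn] /=; first exact: star0.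
  by rewrite /T starZ fmorphV rmorph_nat starD hs starM IHn.
have [|l ul] := @anorm_complete _ A u.
  apply: (contraction_cauchy r0 h1) => n.
  apply: le_trans (Tdist _ _) _.
  rewrite mulrA ler_wpM2r ?anorm_ge0 // ler_pdivrMl // mulr_natl mulr2n.
  exact: lerD (ur n.+1) (ur n).
have lT : T l = l.
  (* [r + anorm l] controls [u n * u n - l * l] in terms of [u n - l]. *)
  pose C := 2^-1 * (r + anorm l) + 1.
  have C0 : 0 <= C by rewrite addr_ge0 // mulr_ge0 // addr_ge0 // anorm_ge0.
  apply: (anorm_small_eq C0) => e e0; have [N hN] := ul e e0.
  apply: le_trans (ler_anorm_dist (u N.+1) _ _) _.
  rewrite /C [X in _ <= X]mulrDl mul1r lerD ?(ltW (hN _ _)) //.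
  rewrite anorm_distC; apply: le_trans (Tdist _ _) _.
  rewrite -mulrA ler_wpM2l //; apply: ler_pM; rewrite ?addr_ge0 ?anorm_ge0 //.
    by rewrite lerD2r.
  by rewrite ltW // hN.
have ls : star l = l.
  apply: (@anorm_small_eq _ _ _ _ 2) => // e e0; have [N hN] := ul e e0.
  apply: le_trans (ler_anorm_dist (u N) _ _) _.
  rewrite mulr_natl mulr2n lerD ?(ltW (hN _ _)) //.
  by rewrite -(us N) -starB anorm_star anorm_distC ltW // hN.
exists (1 - l); first by rewrite starB star1 ls.
(* The fixed point equation, solved for [l * l]. *)
have ll : l * l = l + l - h.
  rewrite -mulr2n -{3}lT /T -scaler_nat scalerA mulfV ?pnatr_eq0 // scale1r.
  by rewrite addrC addKr.
by rewrite mulrBr mulr1 mulrBl mul1r opprB ll [l + l - h - l]addrAC addrK addrA subrK.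
Qed.

End CStar.

(** * Positive functionals and their GNS seminorm *)

Definition state_norm (R : realType) (A : cstarAlgType R) (omega : {scalar A})
    (x : A) : R[i] := sqrtC (omega (star x * x)).

Section State.
Variables (R : realType) (A : cstarAlgType R).
Implicit Types a b x y : A.
Variable omega : {scalar A}.
Hypothesis omega_state : is_state omega.

Let omega_ge0 x : 0 <= omega (star x * x).
Proof. by case: omega_state => pos _; apply: pos. Qed.

Let omega1 : omega 1 = 1.
Proof. by case: omega_state. Qed.

Let omegaD x y : omega (x + y) = omega x + omega y.
Proof. exact: linearD. Qed.

Let omegaB x y : omega (x - y) = omega x - omega y.
Proof. exact: linearB. Qed.

Let omegaZ (k : R[i]) x : omega (k *: x) = k * omega x.
Proof. exact: linearZ. Qed.

(** For [k > anorm a ^+ 2], the element [1 - k^-1 (a^* a)] is the square of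
    some self-adjoint [s], and positivity at [s x] is the inequality with
    factor [k]; then [k] tends to [anorm a ^+ 2]. *)
Lemma state_sqM a x :
  omega (star (a * x) * (a * x)) <= anorm a ^+ 2 * omega (star x * x).
Proof.
have strict k : anorm a ^+ 2 < k ->
    omega (star (a * x) * (a * x)) <= k * omega (star x * x).
  move=> ak; have k0 : 0 < k by apply: le_lt_trans ak; rewrite exprn_ge0 ?anorm_ge0.
  have [||s ss s2] := @sa_sqrt_one_sub R A (k^-1 *: (star a * a)).
  - by rewrite starZ starM starK conj_Creal // ger0_real // invr_ge0 ltW.
  - by rewrite anormZ anorm_starM ger0_norm ?invr_ge0 ?(ltW k0) // ltr_pdivrMl // mulr1.
  have := omega_ge0 (s * x).
  rewrite starM ss mulrA -[star x * s * s]mulrA s2 mulrBr mulr1 mulrBl.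
  rewrite -scalerAr -scalerAl omegaB omegaZ subr_ge0 ler_pdivrMl //.
  by rewrite starM !mulrA.
(* [w] may vanish, hence the denominator [w + 1]. *)
apply/ler_addgt0Pr => e e0; set w := omega (star x * x).
have w1 : 0 < w + 1 by rewrite ltr_wpDl // omega_ge0.
have := strict (anorm a ^+ 2 + e / (w + 1)).
rewrite ltrDl divr_gt0 // => /(_ isT) /le_trans; apply.
rewrite mulrDl lerD2l mulrAC ler_pdivrMr // ler_pM2l // lerDl //.
Qed.

(** By polarization: the values of [omega] at [|1 + a|^2] and [|1 + i a|^2] are
    real, hence so are [omega a + omega (star a)] and
    [i (omega a - omega (star a))]. *)
Lemma state_star a : omega (star a) = (omega a)^*.
Proof.
have sq_real x : omega (star x * x) \is Num.real by rewrite ger0_real.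
(* Up to real terms, this is the value of [omega] at [|1 + c a|^2]. *)
have key (c : R[i]) : (c * omega a + c^* * omega (star a))^*
     = c * omega a + c^* * omega (star a).
  have -> : c * omega a + c^* * omega (star a)
     = omega (star (1 + c *: a) * (1 + c *: a)) - 1 - `|c| ^+ 2 * omega (star a * a).
    rewrite starD star1 starZ mulrDl mulrDr !mul1r mulrDr mulr1 normCK.
    rewrite -scalerAl -scalerAr scalerA !omegaD !omegaZ omega1.
    by ring.
  by apply: conj_Creal; rewrite !rpredB ?rpred1 ?rpredM ?rpredX ?normr_real.
move: (key 1) (key 'i); rewrite conjCi rmorph1 !mul1r !rmorphD !rmorphM /=.
rewrite rmorphN /= conjCi opprK => e1 e2.
have e3 : 2 * 'i * ((omega (star a))^* - omega a) = 0.
  move/eqP: e1; rewrite -subr_eq0 => /eqP e1.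
  move/eqP: e2; rewrite -subr_eq0 => /eqP e2.
  by rewrite -[RHS](addr0 0) -{1}(mulr0 'i) -{1}e1 -e2; ring.
move/eqP: e3; rewrite mulf_eq0 mulf_eq0 pnatr_eq0 (negPf (neq0Ci _)) /= subr_eq0.
by move=> /eqP <-; rewrite conjCK.
Qed.

Let N : A -> R[i] := state_norm omega.

Let N_ge0 x : 0 <= N x.
Proof. by rewrite /N /state_norm sqrtC_ge0 omega_ge0. Qed.

Let N_sqr x : N x ^+ 2 = omega (star x * x).
Proof. exact: sqrtCK. Qed.

Let le_N x (r : R[i]) : 0 <= r -> omega (star x * x) <= r ^+ 2 -> N x <= r.
Proof. by move=> r0; rewrite -N_sqr ler_sqr ?nnegrE. Qed.

Lemma state_normZ (k : R[i]) x : N (k *: x) = `|k| * N x.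
Proof.
rewrite /N /state_norm starZ -scalerAl -scalerAr scalerA omegaZ -normCKC.
by rewrite sqrtCM ?nnegrE ?exprn_ge0 // sqrCK.
Qed.

Lemma state_normM a x : N (a * x) <= anorm a * N x.
Proof.
apply: le_N; first by rewrite mulr_ge0 ?anorm_ge0.
by rewrite exprMn N_sqr state_sqM.
Qed.

Lemma state_norm1 : N 1 = 1.
Proof. by rewrite /N /state_norm star1 mul1r omega1 sqrtC1. Qed.

(** Positivity at [N y * x - N x * y] reads
    [2 Re omega (x^* y) <= 2 N x * N y] after division by [N x * N y];
    faithfulness disposes of the case where this product vanishes. *)
Lemma state_normD x y : is_faithful omega -> N (x + y) <= N x + N y.
Proof.
move=> faithful.
have N_eq0 z : N z = 0 -> z = 0.
  by move=> Nz; apply: faithful; rewrite /abs_sqr -N_sqr Nz expr0n.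
have := N_ge0 x; rewrite le0r => /orP[/eqP Nx0 | Nx].
  by rewrite (N_eq0 _ Nx0) add0r lerDr.
have := N_ge0 y; rewrite le0r => /orP[/eqP Ny0 | Ny].
  by rewrite (N_eq0 _ Ny0) addr0 lerDl.
have expand (u v : R[i]) z t : u^* = u -> v^* = v ->
    omega (star (u *: z + v *: t) * (u *: z + v *: t)) =
    u ^+ 2 * N z ^+ 2 + u * v * (omega (star z * t) + omega (star t * z))
    + v ^+ 2 * N t ^+ 2.
  move=> ur vr; set rhs := RHS.
  rewrite starD !starZ ur vr mulrDl !mulrDr -!scalerAl -!scalerAr.
  by rewrite !omegaD !omegaZ /rhs !N_sqr; ring.
apply: le_N; first by rewrite addr_ge0.
have conjN z : (N z)^* = N z by rewrite conj_Creal // ger0_real.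
have := omega_ge0 (N y *: x + (- N x) *: y).
rewrite expand ?rmorphN /= ?conjN // => pos.
have := expand 1 1 x y; rewrite !scale1r rmorph1 => -> //.
rewrite -subr_ge0 -(pmulr_rge0 _ (mulr_gt0 Nx Ny)).
by move: pos; congr (0 <= _); ring.
Qed.

(** * The standard deviation *)

Let sigma2E a : sigma2 omega a = N (a - (omega a)%:A).
Proof. by []. Qed.

Lemma sigma2_ge0 a : 0 <= sigma2 omega a.
Proof. exact: N_ge0. Qed.

Lemma sigma2Z (k : R[i]) a : sigma2 omega (k *: a) = `|k| * sigma2 omega a.
Proof. by rewrite !sigma2E omegaZ -scalerA -scalerBr; apply: state_normZ. Qed.

Lemma sigma2D a b : is_faithful omega ->
  sigma2 omega (a + b) <= sigma2 omega a + sigma2 omega b.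
Proof.
move=> faithful; rewrite !sigma2E omegaD scalerDl opprD addrACA.
exact: state_normD.
Qed.

Lemma sigma2_1 : sigma2 omega 1 = 0.
Proof.
by rewrite sigma2E omega1 scale1r subrr -(scale0r 1) state_normZ normr0 mul0r.
Qed.

Lemma sigma2_sqr a : sigma2 omega a ^+ 2 = omega (star a * a) - `|omega a| ^+ 2.
Proof.
rewrite sigma2E N_sqr starB starZ star1.
rewrite mulrBl !mulrBr -!scalerAl -!scalerAr !mulr1 !mul1r.
by rewrite !omegaB !omegaZ omega1 state_star normCK; ring.
Qed.

(** Pythagoras: [N (a - k) ^ 2 = sigma2 a ^ 2 + |omega a - k| ^ 2]. *)
Lemma sigma2_le_dist a (k : R[i]) : sigma2 omega a <= N (a - k%:A).
Proof.
rewrite -ler_sqr ?nnegrE ?sigma2_ge0 // sigma2_sqr N_sqr.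
rewrite starB starZ star1 mulrBl !mulrBr -!scalerAl -!scalerAr !mulr1 !mul1r.
rewrite !omegaB !omegaZ omega1 state_star -subr_ge0.
have : 0 <= `|omega a - k| ^+ 2 by rewrite exprn_ge0.
by congr (0 <= _); rewrite !normCK rmorphB; ring.
Qed.

Lemma norm_state_le a : `|omega a| <= anorm a.
Proof.
apply: (@le_trans _ _ (N a)).
  by rewrite -ler_sqr ?nnegrE // N_sqr -subr_ge0 -sigma2_sqr exprn_ge0 ?sigma2_ge0.
by have := state_normM a 1; rewrite state_norm1 !mulr1.
Qed.

(** The Gram determinant of [b] and [w = 1 - omega a * b] equals that of [b]
    and [1], which is the variance of [b]; moreover [w = b (a - omega a)] is
    bounded by [anorm b] times the deviation of [a]. *)
Lemma sigma2_inv a b : b * a = 1 -> sigma2 omega b <= anorm b ^+ 2 * sigma2 omega a.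
Proof.
move=> ba1; pose w := b * (a - (omega a)%:A).
have wE : w = 1 - omega a *: b by rewrite /w mulrBr ba1 -scalerAr mulr1.
(* The [omega a] terms cancel: this is invariance under column operations. *)
have gram : sigma2 omega b ^+ 2 = N b ^+ 2 * N w ^+ 2 - `|omega (star b * w)| ^+ 2.
  rewrite sigma2_sqr !N_sqr wE starB starZ star1.
  rewrite mulrBl !mulrBr -!scalerAl -!scalerAr !mulr1 !mul1r.
  rewrite !omegaB !omegaZ omega1 state_star !normCK rmorphB rmorphM /= conjCK.
  rewrite (conj_Creal (ger0_real (omega_ge0 b))).
  by ring.
rewrite -ler_sqr ?nnegrE ?mulr_ge0 ?exprn_ge0 ?anorm_ge0 ?sigma2_ge0 // gram.
apply: (@le_trans _ _ (N b ^+ 2 * N w ^+ 2)).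
  by rewrite gerBl exprn_ge0.
have Nb : N b <= anorm b.
  by have := state_normM b 1; rewrite state_norm1 !mulr1.
rewrite -exprMn ler_sqr ?nnegrE ?mulr_ge0 ?exprn_ge0 ?anorm_ge0 ?sigma2_ge0 //.
by rewrite expr2 -mulrA ler_pM // state_normM.
Qed.

Lemma sigma2M a b : is_faithful omega ->
  sigma2 omega (a * b) <= anorm a * sigma2 omega b + anorm b * sigma2 omega a.
Proof.
move=> faithful; apply: le_trans (sigma2_le_dist _ (omega b * omega a)) _.
have -> : a * b - (omega b * omega a)%:A
    = a * (b - (omega b)%:A) + omega b *: (a - (omega a)%:A).
  by rewrite mulrBr -scalerAr mulr1 scalerBr scalerA addrA subrK.
apply: le_trans (state_normD _ _ faithful) _.
apply: lerD (state_normM _ _) _.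
by rewrite state_normZ ler_wpM2r ?N_ge0 // norm_state_le.
Qed.

End State.

Theorem theorem3p3 (R : realType) (A : cstarAlgType R) (omega : {scalar A}) :
  is_state omega -> is_faithful omega ->
  is_seminorm (sigma2 omega) /\ strongly_leibniz (sigma2 omega).
Proof.
move=> state faithful; split; split.
- by move=> a; apply: sigma2_ge0.
- by move=> k a; apply: sigma2Z.
- by move=> a b; apply: sigma2D.
- exact: sigma2_1.
- by move=> a b; apply: sigma2M.
- by move=> a b _ ba1; apply: sigma2_inv.
Qed.
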